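(* Fix $\alpha\in(0,1)$. Suppose that $\sigma(x_i,d_i)>0$ for each $i$, and that each unit has a single closest match, i.e. $\operatorname{argmin}_{j:\,d_j\ne d_i}\|x_i-x_j\|_{\mathcal X}$ is a singleton for each $i\in\{1,\dots,n\}$. Then, if the Lipschitz constant $C$ is larger than a constant that depends only on $\sigma^2(x_i,d_i)$ and $\{x_i,d_i\}_{i=1}^n$, the optimal estimators $\hat L_{\delta_{\mathrm{RMSE}}}$ and $\hat L_{\delta_{\mathrm{FLCI}}}$ (computed for the class $\mathcal F=\mathcal F_{\mathrm{Lip}}(C)$) are both given by the matching estimator with $M=1$ match.
   Context: Fixed design Gaussian regression: $x_i\in\mathbb R^p$, $d_i\in\{0,1\}$ nonrandom, $Y_i=f(x_i,d_i)+u_i$, $u_i\sim N(0,\sigma^2(x_i,d_i))$ independent, $\sigma^2$ known. $\|\cdot\|_{\mathcal X}$ is a norm on $\mathbb R^p$, $$\mathcal F_{\mathrm{Lip}}(C)=\{f:\mathbb R^p\times\{0,1\}\to\mathbb R:\ |f(x,d)-f(\tilde x,d)|\le C\|x-\tilde x\|_{\mathcal X}\ \text{for all }x,\tilde x,\ d\in\{0,1\}\},$$ and $Lf=\frac1n\sum_{i=1}^n[f(x_i,1)-f(x_i,0)]$. For a linear estimator $\hat L_k=\sum_i k(x_i,d_i)Y_i$, $\mathrm{sd}(\hat L_k)^2=\sum_i k(x_i,d_i)^2\sigma^2(x_i,d_i)$ and $\overline{\mathrm{bias}}_{\mathcal F}(\hat L_k)=\sup_{f\in\mathcal F}[\sum_i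 k(x_i,d_i)f(x_i,d_i)-Lf]$. For $\delta>0$, let $f^*_\delta$ solve $\max_{f\in\mathcal F}2Lf$ s.t. $\sum_i f(x_i,d_i)^2/\sigma^2(x_i,d_i)\le\delta^2/4$, with $\mathcal F=\mathcal F_{\mathrm{Lip}}(C)$, and let $\hat L_\delta=\hat L_{k^*_\delta}$ with $$k^*_\delta(x_i,d_i)=\frac{f^*_\delta(x_i,d_i)/\sigma^2(x_i,d_i)}{\sum_{j=1}^n d_jf^*_\delta(x_j,d_j)/\sigma^2(x_j,d_j)}.$$ $\delta_{\mathrm{RMSE}}$ minimizes $\overline{\mathrm{bias}}_{\mathcal F}(\hat L_\delta)^2+\mathrm{sd}(\hat L_\delta)^2$ over $\delta>0$, and $\delta_{\mathrm{FLCI}}$ minimizes $\mathrm{cv}_\alpha\big(\overline{\mathrm{bias}}_{\mathcal F}(\hat L_\delta)/\mathrm{sd}(\hat L_\delta)\big)\cdot\mathrm{sd}(\hat L_\delta)$ over $\delta>0$, where $\mathrm{cv}_\alpha(b)$ is the $1-\alpha$ quantile of the $|N(b,1)|$ distribution. The matching estimator with $M=1$ is $\hat L_k$ with $k(x_i,d_i)=\frac1n(2d_i-1)(1+K_1(i))$, where $K_1(i)$ is the number of units $j$ with $d_j=1-d_i$ whose closest unit (in $\|\cdot\|_{\mathcal X}$) among units with treatment status $1-d_j=d_i$ is $i$.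
   Formalization: Added assumption: some unit has no unit with identical covariates in the other treatment arm, or σ² is constant over the units of each arm; when all matches are exact and σ² varies within an arm, the claim fails for every C. *)

(* Defs.v *)
From HB Require Import structures.
From mathcomp Require Import all_boot all_order all_algebra.
From mathcomp Require Import all_classical all_reals all_analysis.

Set Implicit Arguments.
Unset Strict Implicit.
Unset Printing Implicit Defensive.

Import Order.TTheory GRing.Theory Num.Theory.
Local Open Scope ring_scope.

(* The norm of the covariate space is an arbitrary one, not the canonical
   sup-norm carried by 'rV[R]_p. *)
Record is_norm (R : realType) (p : nat) (N : 'rV[R]_p -> R) : Prop := IsNorm {
  norm_triangle : forall x y, N (x + y) <= N x + N y;
  norm_homogeneous : forall a x, N (a *: x) = `|a| * N x;
  norm_definite : forall x, N x = 0 -> x = 0 }.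

Section Regression.
Context (R : realType) (n p : nat).
Context (N : 'rV[R]_p -> R).
Context (x : 'I_n -> 'rV[R]_p) (d : 'I_n -> bool).
(* [sigma2 z t] is the conditional variance at covariate z, treatment t. *)
Context (sigma2 : 'rV[R]_p -> bool -> R).

Definition lipschitz_class (C : R) : set ('rV[R]_p -> bool -> R) :=
  [set f | forall t y z, `|f y t - f z t| <= C * N (y - z)]%classic.

Definition sample_ate (f : 'rV[R]_p -> bool -> R) : R :=
  n%:R^-1 * \sum_(i < n) (f (x i) true - f (x i) false).

(* A linear estimator is given by its weights k i = k(x_i, d_i); Y is the
   vector of outcomes. *)
Definition linear_estimator (k Y : 'I_n -> R) : R := \sum_(i < n) k i * Y i.

Definition sd (k : 'I_n -> R) : R :=
  Num.sqrt (\sum_(i < n) k i ^+ 2 * sigma2 (x i) (d i)).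

(* Extended-real valued: it is +oo for weights under which no Lipschitz
   constant bounds the bias. *)
Definition worst_bias (F : set ('rV[R]_p -> bool -> R)) (k : 'I_n -> R) :
    \bar R :=
  ereal_sup
    [set (\sum_(i < n) k i * f (x i) (d i) - sample_ate f)%:E | f in F]%classic.

Definition modulus_feasible (C delta : R) (f : 'rV[R]_p -> bool -> R) : Prop :=
  lipschitz_class C f /\
  \sum_(i < n) f (x i) (d i) ^+ 2 / sigma2 (x i) (d i) <= delta ^+ 2 / 4.

Definition modulus_solution (C delta : R) (f : 'rV[R]_p -> bool -> R) : Prop :=
  modulus_feasible C delta f /\
  forall g, modulus_feasible C delta g ->
    2 * sample_ate g <= 2 * sample_ate f.

Definition modulus_weights (f : 'rV[R]_p -> bool -> R) (i : 'I_n) : R :=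
  (f (x i) (d i) / sigma2 (x i) (d i)) /
  \sum_(j < n) (d j)%:R * f (x j) (d j) / sigma2 (x j) (d j).

Definition mean_squared_error (F : set ('rV[R]_p -> bool -> R))
    (k : 'I_n -> R) : \bar R :=
  (worst_bias F k ^+ 2 + (sd k ^+ 2)%:E)%E.

(* The 1 - alpha quantile of |Z| for Z ~ N(b, 1). *)
Definition cv (alpha b : R) : R :=
  inf [set c : R |
    ((1 - alpha)%:E <= normal_prob b 1 [set z : R | (`|z| <= c)%R])%E]%classic.

Definition flci_half_length (alpha : R) (F : set ('rV[R]_p -> bool -> R))
    (k : 'I_n -> R) : \bar R :=
  match worst_bias F k with
  | EFin b => (cv alpha (b / sd k) * sd k)%:E
  | _ => +oo%E
  end.

Definition closest_matches (i : 'I_n) : {set 'I_n} :=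
  [set j | (d j != d i) &&
    [forall l, (d l != d i) ==> (N (x i - x j) <= N (x i - x l))]]%SET.

(* K_1(i): the number of units of the other arm matched to i. *)
Definition match_count (i : 'I_n) : nat :=
  #|[set j | (d j == ~~ d i) && (i \in closest_matches j)]%SET|.

Definition matching_weights (i : 'I_n) : R :=
  n%:R^-1 * (2 * (d i)%:R - 1) * (1 + (match_count i)%:R).

(* Without [inexact_match] every unit has a match with the same covariates and
   the matching estimator has zero worst-case bias.  The squared bias is then
   of second order near the matching weights while the variance is in general
   of first order, so however large C is, matching does not minimize the
   mean squared error unless [arm_homoskedastic] holds.  For instance, take
   pairs at covariates 0 and 1 with variances 1 and 100 in both arms: weights
   1/2 + e and 1/2 - e on the pairs have mean squared error
   4 C^2 e^2 + 2 ((1/2 + e)^2 + 100 (1/2 - e)^2), which is smaller for small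
   e > 0 than for e = 0, and they arise from some delta > 0. *)
Definition inexact_match : Prop :=
  exists i, forall j, d j != d i -> x j != x i.

Definition arm_homoskedastic : Prop :=
  forall i j, d i = d j -> sigma2 (x i) (d i) = sigma2 (x j) (d j).

End Regression.

Definition minimizes_pos (R : realType) (F : R -> \bar R) (delta : R) : Prop :=
  0 < delta /\ forall delta', 0 < delta' -> (F delta <= F delta')%E.

(* Main.v *)
(* Write w for the weights of the matching estimator and b0 for the average
   distance of a unit to its match.  Because matches are unique, McShane
   extension of small perturbations of the outcome zero at the sample points
   shows that the worst-case bias over Lip(C) of any weights k is at least
   C b0 + C rho |k - w|_1 with rho > 0 depending on the design only, with
   equality at w: matching is a sharp minimizer of the bias.

   If b0 > 0, the bias lost by moving away from w is of order C, whereas the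
   standard deviation is Lipschitz in k, so for large C both criteria are
   strictly minimized at w.  For the confidence interval one compares the
   probability that N(bias, sd^2) lies in [- c, c]: as C grows, c - bias stays
   bounded in units of sd while the other endpoint escapes to infinity, where
   the Gaussian density is negligible.

   If b0 = 0, all matches are exact, every match count is one, and under
   homoskedasticity within arms w also minimizes the variance among the weights
   with finite bias.

   Finally w is attained: for small delta the modulus problem is, by uniqueness
   of the matches, the maximization of a linear form over an ellipsoid, whose
   unique solution yields the weights w. *)
From HB Require Import structures.
Require Import Defs.
From mathcomp Require Import all_boot all_order all_algebra.
From mathcomp Require Import all_classical all_reals all_analysis.
From mathcomp Require Import ring lra.

Import Order.TTheory GRing.Theory Num.Theory.
Import numFieldNormedType.Exports.
Local Open Scope ring_scope.

Set Implicit Arguments.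
Unset Strict Implicit.

(** * Gaussian critical values *)

Section Gaussian.
Context {R : realType}.
Implicit Types (a b c t : R).

Definition gauss_pdf : R -> R := normal_pdf 0 1.

Definition gauss_cdf (t : R) : R :=
  (\int[lebesgue_measure]_(z in `]-oo, t]%classic) gauss_pdf z)%R.

Lemma gauss_pdfE t : gauss_pdf t = normal_peak 1 * expR (- t ^+ 2 / 2).
Proof.
rewrite /gauss_pdf normal_pdfE ?oner_neq0// /normal_fun subr0.
by rewrite expr1n mulr2n.
Qed.

Lemma gauss_pdf_gt0 t : 0 < gauss_pdf t.
Proof. by rewrite gauss_pdfE mulr_gt0 ?expR_gt0 ?normal_peak_gt0. Qed.

Lemma gauss_pdf_le a b : `|a| <= `|b| -> gauss_pdf b <= gauss_pdf a.
Proof.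
move=> ab; rewrite !gauss_pdfE ler_pM2l ?normal_peak_gt0// ler_expR.
rewrite ler_pM2r ?invr_gt0// lerN2 -(real_normK (num_real a)).
by rewrite -(real_normK (num_real b)) lerXn2r ?nnegrE.
Qed.

Lemma continuous_gauss_pdf : continuous gauss_pdf.
Proof. exact: continuous_normal_pdf. Qed.

Lemma is_derive_gauss_cdf t : is_derive t (1 : R) gauss_cdf (gauss_pdf t).
Proof.
have tt1 : t < t + 1 by rewrite ltrDl.
have ig : (@lebesgue_measure R).-integrable
    [set` Interval -oo%O (BRight (t + 1))] (EFin \o gauss_pdf).
  apply: (@integrableS _ _ _ _ setT) => //.
  exact: integrable_normal_pdf.
have h := @continuous_FTC1 _ _ -oo%O t (t + 1) tt1 ig.
have [|d e] := h _ (@continuous_gauss_pdf t); first by rewrite ltNyr.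
by apply: DeriveDef => //; rewrite -derive1E.
Qed.

Lemma normal_prob_ball b c : 0 <= c ->
  normal_prob b 1 [set z : R | `|z| <= c]%classic =
  (gauss_cdf (c - b) - gauss_cdf (- c - b))%:E.
Proof.
rewrite le_eqVlt => /orP[/eqP <-|c0].
  (* The fundamental theorem of calculus is applied below on [[- c, c]], which has to be
     nondegenerate. *)
  rewrite oppr0 subrr (_ : [set z : R | `|z| <= 0]%classic = [set 0]%classic).
    by rewrite /normal_prob integral_set1.
  by apply/seteqP; split => z /=; [rewrite normr_le0 => /eqP| move=> ->; rewrite normr0].
have -> : [set z : R | `|z| <= c]%classic = `[- c, c]%classic.
  by apply/seteqP; split => z /=; rewrite in_itv/= ler_norml.
have D z : is_derive z (1 : R) (fun y => gauss_cdf (y - b)) (normal_pdf b 1 z).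
  have -> : normal_pdf b 1 z = gauss_pdf (z - b) * (1 : R).
    by rewrite mulr1 gauss_pdfE normal_pdfE ?oner_neq0// /normal_fun expr1n mulr2n.
  apply: (@is_derive1_comp _ gauss_cdf (fun y : R => y - b)).
    exact: is_derive_gauss_cdf.
  by have := is_deriveB (is_derive_id z (1 : R)) (is_derive_cst b z 1); rewrite subr0.
have cont z : {for z, continuous (fun y => gauss_cdf (y - b))}.
  by apply: differentiable_continuous; apply/derivable1_diffP; case: (D z).
rewrite /normal_prob (@continuous_FTC2 _ _ (fun y => gauss_cdf (y - b))) ?EFinB//.
- lra.
- apply: continuous_subspaceT; apply: continuous_normal_pdf; exact: oner_neq0.
- split.
  + by move=> z _; case: (D z).
  + by apply: cvg_at_right_filter; exact: cont.
  + by apply: cvg_at_left_filter; exact: cont.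
- by move=> z _; rewrite derive1E; case: (D z).
Qed.

Lemma gauss_cdf_mvt a b : a <= b ->
  exists2 t, a <= t <= b & gauss_cdf b - gauss_cdf a = gauss_pdf t * (b - a).
Proof.
move=> ab.
have [||t] := @MVT_segment _ gauss_cdf gauss_pdf a b ab.
- by move=> z _; exact: is_derive_gauss_cdf.
- apply: continuous_subspaceT => z; apply: differentiable_continuous.
  by apply/derivable1_diffP; case: (is_derive_gauss_cdf z).
- by rewrite in_itv/=; exists t.
Qed.

(** As a random variable under the standard normal law, the identity has distribution function
    [gauss_cdf], whose limits at infinity are thus those of a [cdf]. *)
Let idR : measurableTypeR R -> R := idfun.

#[local] HB.instance Definition _ :=
  @isMeasurableFun.Build _ _ _ _ idR (@measurable_id _ _ setT).

Let gauss_cdfE :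
  gauss_cdf = fine \o cdf (idR : {RV normal_prob (0 : R) 1 >-> R}).
Proof. by []. Qed.

Lemma gauss_cdf_cvgy : (gauss_cdf t @[t --> +oo%R] --> (1 : R))%classic.
Proof. rewrite gauss_cdfE; exact/fine_cvg/cvg_cdfy1. Qed.

Lemma gauss_cdf_cvgNy : (gauss_cdf t @[t --> -oo%R] --> (0 : R))%classic.
Proof. rewrite gauss_cdfE; exact/fine_cvg/cvg_cdfNy0. Qed.

Lemma gauss_cdf_nd a b : a <= b -> gauss_cdf a <= gauss_cdf b.
Proof.
move=> ab; have [t _ e] := gauss_cdf_mvt ab.
by rewrite -subr_ge0 e mulr_ge0 ?subr_ge0// ltW// gauss_pdf_gt0.
Qed.

Lemma gauss_cdf_tail e : 0 < e -> exists2 q : R, 0 < q &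
  forall t, q <= t -> 1 - gauss_cdf t < e /\ gauss_cdf (- t) < e.
Proof.
move=> e0.
have /cvgrPdist_lt/(_ _ e0)[a [_ Ha]] := gauss_cdf_cvgy.
have /cvgrPdist_lt/(_ _ e0)[b [_ Hb]] := gauss_cdf_cvgNy.
exists (Num.max 1 (Num.max (a + 1) (1 - b))); first by rewrite lt_max ltr01.
move=> t; rewrite !ge_max => /and3P[_ ta tb]; split.
  have /Ha : a < t by lra.
  by apply: le_lt_trans; exact: ler_norm.
have /Hb : - t < b by lra.
by apply: le_lt_trans; rewrite sub0r normrN ler_norm.
Qed.

End Gaussian.

(** * Critical values of the absolute value of a normal variable *)

Section CriticalValue.
Context {R : realType}.
Implicit Types (a b c t B s : R).

Lemma gauss_cdf_ge0 t : 0 <= gauss_cdf t.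
Proof. by apply: Rintegral_ge0 => z _; exact: ltW (gauss_pdf_gt0 z). Qed.

Definition folded_cdf b c : R := gauss_cdf (c - b) - gauss_cdf (- c - b).

Lemma folded_cdf_nd b c c' : c <= c' -> folded_cdf b c <= folded_cdf b c'.
Proof. by move=> cc'; apply: lerB; apply: gauss_cdf_nd; lra. Qed.

Lemma folded_cdf_lt b c c' : c < c' -> folded_cdf b c < folded_cdf b c'.
Proof.
move=> cc'; apply: ltr_leB; last by apply: gauss_cdf_nd; lra.
have [|t _ e] := @gauss_cdf_mvt R (c - b) (c' - b); first by lra.
by rewrite -subr_gt0 e mulr_gt0 ?gauss_pdf_gt0//; lra.
Qed.

Lemma folded_cdf_center b c : 0 <= b -> 0 <= c ->
  folded_cdf b c <= folded_cdf 0 c.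
Proof.
move=> b0 c0; rewrite /folded_cdf !subr0.
(* If the windows [[- c, c]] and [[- c - b, c - b]] overlap, only the two pieces of length [b] where
   they differ are compared; otherwise the whole windows are. *)
have [b2c|b2c] := leP b (2 * c).
  have [|t1 t1P e1] := @gauss_cdf_mvt R (- c - b) (- c); first by lra.
  have [|t2 t2P e2] := @gauss_cdf_mvt R (c - b) c; first by lra.
  have : gauss_pdf t1 * b <= gauss_pdf t2 * b.
    apply: ler_wpM2r => //; apply: gauss_pdf_le.
    by rewrite ler_norml; have := ler_norm (- t1); rewrite normrN; lra.
  have e3 : - c - (- c - b) = b by ring.
  have e4 : c - (c - b) = b by ring.
  by move: e1 e2; rewrite e3 e4; lra.
have [|t1 t1P ->] := @gauss_cdf_mvt R (- c - b) (c - b); first by lra.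
have [|t2 t2P ->] := @gauss_cdf_mvt R (- c) c; first by lra.
rewrite (_ : c - b - (- c - b) = c - - c); last by ring.
apply: ler_wpM2r; first by lra.
apply: gauss_pdf_le.
by rewrite ler_norml; have := ler_norm (- t1); rewrite normrN; lra.
Qed.

Context (alpha : R) (alpha_gt0 : 0 < alpha) (alpha_lt1 : alpha < 1).

(** The folded distribution function is continuous, strictly increasing, zero at 0 and at least
    [1 - alpha] far out, so the set whose infimum defines [cv] is a closed half-line. *)
Lemma cvP b : 0 < cv alpha b /\ folded_cdf b (cv alpha b) = 1 - alpha.
Proof.
have [a0 a1] : 0 < alpha /\ alpha < 1 by [].
have a2 : 0 < alpha / 2 by rewrite divr_gt0.
have [q q0 Hq] := gauss_cdf_tail a2.
pose c1 := q + `|b|.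
have gc1 : 1 - alpha <= folded_cdf b c1.
  have [h1 h2] := Hq q (lexx q).
  have ? : gauss_cdf q <= gauss_cdf (c1 - b).
    by apply: gauss_cdf_nd; rewrite /c1; have := ler_norm b; lra.
  have ? : gauss_cdf (- c1 - b) <= gauss_cdf (- q).
    by apply: gauss_cdf_nd; rewrite /c1; have := ler_norm (- b); rewrite normrN; lra.
  by rewrite /folded_cdf; lra.
have g0 : folded_cdf b 0 = 0 by rewrite /folded_cdf oppr0 subrr.
have c10 : 0 <= c1 by rewrite /c1 addr_ge0// ltW.
have [||c cP gc] := @IVT R (folded_cdf b) 0 c1 (1 - alpha) c10.
- apply: continuous_subspaceT => z.
  have ct y : {for y, continuous (@gauss_cdf R)}.
    apply: differentiable_continuous; apply/derivable1_diffP.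
    by case: (is_derive_gauss_cdf y).
  rewrite /folded_cdf; apply: cvgB.
    apply: (continuous_comp (f := fun c => c - b)); last exact: ct.
    by apply: cvgB; [exact: cvg_id|exact: cvg_cst].
  apply: (continuous_comp (f := fun c => - c - b)); last exact: ct.
  by apply: cvgB; [apply: cvgN; exact: cvg_id|exact: cvg_cst].
- by rewrite g0 ge_min le_max gc1 orbT andbT; apply/orP; left; lra.
suff -> : cv alpha b = c.
  split=> //; move: cP; rewrite in_itv/= le_eqVlt => /andP[/orP[/eqP c0|//] _].
  by move: gc; rewrite -c0 g0; lra.
rewrite /cv (_ : [set _ | _]%classic = `[c, +oo[%classic); first by rewrite inf_itv ?bnd_simp.
apply/seteqP; split => z /=; rewrite in_itv/= andbT.
  have [z0|z0] := leP 0 z.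
    rewrite normal_prob_ball// lee_fin -gc => h.
    by rewrite leNgt; apply/negP => /(folded_cdf_lt b); rewrite ltNge => /negP.
  rewrite (_ : [set _ | _]%classic = set0); first by rewrite measure0 lee_fin; lra.
  by apply/seteqP; split => y //= yz; have := normr_ge0 y; lra.
move: cP; rewrite in_itv/= => /andP[c0 _] cz.
rewrite normal_prob_ball ?(le_trans c0)// lee_fin -gc.
exact: folded_cdf_nd.
Qed.

Lemma lt_cv b c : folded_cdf b c < 1 - alpha -> c < cv alpha b.
Proof.
have [_ <-] := cvP b; rewrite !ltNge; apply: contra.
exact: folded_cdf_nd.
Qed.

(** The far tail fades as [b] grows, so the critical value follows [b] at a bounded distance:
    [b + q] covers enough mass, and anything below [b - r] too little. *)
Lemma cv_sub_bounded :
  exists2 K, 0 < K & forall b, 0 <= b -> `|cv alpha b - b| <= K.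
Proof.
have [a0 a1] : 0 < alpha /\ alpha < 1 by [].
have a2 : 0 < alpha / 2 by rewrite divr_gt0.
have [q q0 Hq] := gauss_cdf_tail a2.
have a3 : 0 < 1 - alpha by rewrite subr_gt0.
have [r r0 Hr] := gauss_cdf_tail a3.
exists (Num.max q r) => [|b b0]; first by rewrite lt_max q0.
have [cv0 cvE] := cvP b.
have ? : cv alpha b <= b + q.
  rewrite leNgt; apply/negP => /(folded_cdf_lt b); rewrite cvE.
  rewrite /folded_cdf (_ : b + q - b = q); last by ring.
  have [? ?] := Hq q (lexx q).
  have ? : gauss_cdf (- (b + q) - b) <= gauss_cdf (- q).
    by apply: gauss_cdf_nd; lra.
  by lra.
have ? : b - r <= cv alpha b.
  rewrite leNgt; apply/negP => lt; move: cvE; rewrite /folded_cdf.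
  have [_ ?] := Hr r (lexx r).
  have ? : gauss_cdf (cv alpha b - b) <= gauss_cdf (- r).
    by apply: gauss_cdf_nd; lra.
  by have := gauss_cdf_ge0 (- cv alpha b - b); lra.
by rewrite ler_norml lerNl le_max; apply/andP; split; rewrite ?le_max; apply/orP; [right|left]; lra.
Qed.

(* The mass lost at the moderate end [p] is of the order of the displacement,
   while the mass gained at the far end [- r] is negligible. *)
Lemma gauss_cdf_exchange K kappa : 0 < K -> 0 <= kappa ->
  exists U : R, forall p0 p1 r0 r1 : R, `|p0| <= K -> U <= r0 -> p1 < p0 ->
    r1 - r0 <= kappa * (p0 - p1) ->
    gauss_cdf p1 - gauss_cdf (- r1) < gauss_cdf p0 - gauss_cdf (- r0).
Proof.
move=> K0 k0.
have fK := @gauss_pdf_gt0 R (K + 1).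
(* Tail mass beyond [q] below this level bounds the density at [q + 1], because an interval of unit
   length separates the two points. *)
have fKk : 0 < gauss_pdf (K + 1) / (kappa + 1) by rewrite divr_gt0//; lra.
have [q q0 Hq] := gauss_cdf_tail fKk.
have qfK : gauss_pdf (K + 1) / (kappa + 1) <= gauss_pdf (K + 1).
  have kfK : 0 <= gauss_pdf (K + 1) * kappa by rewrite mulr_ge0// ltW.
  by rewrite ler_pdivrMr; lra.
exists (q + 1) => p0 p1 r0 r1; rewrite ler_norml => /andP[p0l p0u] Ur0 p10 rk.
have pdfU : gauss_pdf (q + 1) * (kappa + 1) < gauss_pdf (K + 1).
  rewrite -ltr_pdivlMr; last by lra.
  have [_] := Hq q (lexx q); apply: le_lt_trans.
  have [|t tP e] := @gauss_cdf_mvt R (- (q + 1)) (- q); first by lra.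
  have : gauss_pdf (q + 1) <= gauss_pdf t.
    apply: gauss_pdf_le; rewrite (gtr0_norm (_ : 0 < q + 1)) ?ler_norml; lra.
  move: e; rewrite (_ : - q - - (q + 1) = 1) ?mulr1; last by ring.
  by have := gauss_cdf_ge0 (- (q + 1)); lra.
(* Capping the displacement at 1 keeps [[p0 - h, p0]] inside [[- (K + 1), K + 1]], where the density
   is at least [gauss_pdf (K + 1)]. *)
pose h := Num.min (p0 - p1) 1.
have h0 : 0 < h by rewrite lt_min ltr01 subr_gt0 p10.
have loss : gauss_pdf (K + 1) * h <= gauss_cdf p0 - gauss_cdf p1.
  have h1 : h <= 1 by rewrite ge_min lexx orbT.
  have hp : h <= p0 - p1 by rewrite ge_min lexx.
  have [|t tP e] := @gauss_cdf_mvt R (p0 - h) p0; first by lra.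
  have : gauss_pdf (K + 1) * h <= gauss_pdf t * h.
    apply: ler_wpM2r; first exact: ltW.
    apply: gauss_pdf_le; rewrite (gtr0_norm (_ : 0 < K + 1)) ?ler_norml; lra.
  have : gauss_cdf p1 <= gauss_cdf (p0 - h) by apply: gauss_cdf_nd; lra.
  by move: e; rewrite (_ : p0 - (p0 - h) = h); [lra|ring].
suff : gauss_cdf (- r0) - gauss_cdf (- r1) < gauss_pdf (K + 1) * h by lra.
have fh0 : 0 < gauss_pdf (K + 1) * h by rewrite mulr_gt0.
have [rr|rr] := leP r1 r0.
  by have : gauss_cdf (- r0) <= gauss_cdf (- r1) by [apply: gauss_cdf_nd; lra]; lra.
(* After a displacement above 1, the whole tail beyond [- r0] is already smaller than the loss. *)
have [p1'|p1'] := leP (p0 - p1) 1; last first.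
  have -> : h = 1 by rewrite /h min_r// ltW.
  have [_ ?] := Hq r0 ltac:(lra).
  by have := gauss_cdf_ge0 (- r1); lra.
rewrite {loss fh0} (_ : h = p0 - p1); last by rewrite /h min_l.
have [|t tP ->] := @gauss_cdf_mvt R (- r1) (- r0); first by lra.
have ft : gauss_pdf t <= gauss_pdf (q + 1).
  apply: gauss_pdf_le; rewrite (gtr0_norm (_ : 0 < q + 1)); last by lra.
  by have := ler_norm (- t); rewrite normrN; lra.
apply: (@le_lt_trans _ _ (gauss_pdf (q + 1) * (kappa * (p0 - p1)))).
  by apply: ler_pM; [exact: ltW (gauss_pdf_gt0 _)|lra|exact: ft|lra].
rewrite mulrA ltr_pM2r; last by lra.
by have := @gauss_pdf_gt0 R (q + 1); lra.
Qed.

(** Bias only lowers the coverage of a symmetric interval, and a larger scale lowers it strictly. *)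
Lemma cv_scale_lt_exact B s s0 : 0 <= B -> 0 < s0 -> s0 < s ->
  cv alpha 0 * s0 < cv alpha (B / s) * s.
Proof.
move=> B0 s00 s0s; have s_gt0 := lt_trans s00 s0s.
have [c0 cE] := cvP 0.
suff : cv alpha 0 * s0 / s < cv alpha (B / s) by rewrite (ltr_pdivrMr _ _ s_gt0).
apply: lt_cv.
have cs0 : 0 <= cv alpha 0 * s0 / s by rewrite divr_ge0 ?mulr_ge0// ltW.
apply: le_lt_trans (folded_cdf_center _ cs0) _; first by rewrite divr_ge0// ltW.
rewrite -cE; apply: folded_cdf_lt.
by rewrite (ltr_pdivrMr _ _ s_gt0) (ltr_pM2l c0).
Qed.

(** Here [B], [s] and [t] are the bias, standard deviation and distance from matching of competing
    weights. The half-length optimal for matching is shown to undercover for the competitor: the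
    near endpoint retreats, while the far one advances by a comparable amount at most. *)
Lemma cv_scale_lt_inexact (b0 s0 rho M : R) :
  0 < b0 -> 0 < s0 -> 0 < rho -> 0 <= M ->
  exists C0 : R, forall C, C0 < C -> forall B s t : R, 0 < s -> 0 < t ->
    C * b0 + C * rho * t <= B -> `|s - s0| <= M * t ->
    cv alpha (C * b0 / s0) * s0 < cv alpha (B / s) * s.
Proof.
move=> b0_gt0 s0_gt0 rho_gt0 M_ge0.
have [K K0 HK] := cv_sub_bounded.
(* Ratio of the largest far displacement to [D / 2], the least near displacement, both multiplied by
   [s]; [D] is the excess bias. *)
pose kappa := 2 * (1 + M * (K + 2 * (b0 / s0)) / rho).
have bs0 : 0 < b0 / s0 by rewrite divr_gt0.
have k0 : 0 <= kappa.
  by rewrite /kappa mulr_ge0// addr_ge0// divr_ge0 ?(ltW rho_gt0)// mulr_ge0//; lra.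
have [U HU] := gauss_cdf_exchange K0 k0.
(* The second bound makes the change of scale cost at most half of the excess bias at the near end;
   the third pushes the far endpoint beyond [U]. *)
exists (Num.max 1 (Num.max (2 * K * M / rho) (U * s0 / b0))) => C.
rewrite !gt_max => /and3P[C1 C2 C3] B s t s_gt0 t_gt0 HB Hs.
have Cb : 0 <= C * b0 / s0 by rewrite divr_ge0 ?(ltW s0_gt0)// mulr_ge0 ?(ltW b0_gt0)//; lra.
have [cv_gt0 cvE] := cvP (C * b0 / s0).
have := HK _ Cb; set v := cv alpha _ in cv_gt0 cvE * => Hv.
suff : v * s0 / s < cv alpha (B / s) by rewrite (ltr_pdivrMr _ _ s_gt0).
apply: lt_cv; rewrite -cvE /folded_cdf.
rewrite -(opprD v) -(opprD (v * s0 / s)).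
(* For matching, the standardized interval is [[- r0, p0]]. *)
pose p0 := v - C * b0 / s0; pose r0 := v + C * b0 / s0.
pose D := B - C * b0.
have Ct : C * t * rho <= D by rewrite /D; lra.
have D0 : 0 < D by apply: lt_le_trans Ct; rewrite !mulr_gt0//; lra.
have sM := Hs; rewrite ler_norml in sM; case/andP: sM => sM1 sM2.
have Hp : s * (p0 - (v * s0 / s - B / s)) = D + p0 * (s - s0).
  by rewrite /D /p0; field; lra.
have Hr : s * (v * s0 / s + B / s - r0) = D - r0 * (s - s0).
  by rewrite /D /r0; field; lra.
have pK : `|p0 * (s - s0)| <= K * (M * t) by rewrite normrM ler_pM.
have DK : 2 * (K * (M * t)) <= D.
  apply: le_trans Ct; move: C2; rewrite ltr_pdivrMr// => C2.
  rewrite (_ : 2 * _ = 2 * K * M * t); last by ring.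
  by rewrite (mulrAC C) ler_pM2r// ltW.
have Hp' : D / 2 <= s * (p0 - (v * s0 / s - B / s)).
  by rewrite Hp; move: pK; rewrite ler_norml; lra.
have r0_ge0 : 0 <= r0 by rewrite /r0 addr_ge0// ltW.
have r0_le : r0 <= C * (K + 2 * (b0 / s0)).
  have : v <= K + C * b0 / s0 by move: Hv; rewrite ler_norml; lra.
  have : K <= C * K by rewrite ler_peMl ?(ltW K0)//; lra.
  by rewrite /r0; lra.
have Hr' : s * (v * s0 / s + B / s - r0) <= kappa * (D / 2).
  rewrite Hr.
  have : - (r0 * (s - s0)) <= r0 * (M * t).
    by rewrite -mulrN; apply: ler_wpM2l => //; lra.
  have : r0 * (M * t) <= C * (K + 2 * (b0 / s0)) * (M * t).
    by apply: ler_wpM2r => //; rewrite mulr_ge0// ltW.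
  have : C * (K + 2 * (b0 / s0)) * (M * t) <= M * (K + 2 * (b0 / s0)) / rho * D.
    have -> : C * (K + 2 * (b0 / s0)) * (M * t) =
        M * (K + 2 * (b0 / s0)) / rho * (C * t * rho) by field; lra.
    apply: ler_wpM2l Ct; rewrite divr_ge0 ?(ltW rho_gt0)// mulr_ge0//; lra.
  by rewrite /kappa; lra.
apply: HU => //.
- rewrite -/r0; apply: (@le_trans _ _ (C * b0 / s0)); last by rewrite /r0 lerDr ltW.
  by rewrite ler_pdivlMr// -ler_pdivrMr// ltW.
- rewrite -/p0 -subr_gt0 -(pmulr_rgt0 _ s_gt0); apply: lt_le_trans Hp'; lra.
- rewrite -/r0 -/p0 -(ler_pM2l s_gt0) mulrCA; apply: le_trans Hr' _.
  exact: ler_wpM2l.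
Qed.

End CriticalValue.

Lemma finite_pos_lower_bound (R : realType) (I : finType) (P : pred I)
    (g : I -> R) : (forall i, P i -> 0 < g i) ->
  exists2 r, 0 < r & forall i, P i -> r <= g i.
Proof.
move=> g0; exists (\big[Num.min/1]_(i | P i) g i).
  by apply: lt_bigmin => //; exact: ltr01.
by move=> i Pi; exact: bigmin_le_cond.
Qed.

(** * Bias and variance of linear estimators *)

Section Matching.
Context (R : realType) (n p : nat) (N : 'rV[R]_p -> R).
Context (x : 'I_n -> 'rV[R]_p) (d : 'I_n -> bool).
Context (sigma2 : 'rV[R]_p -> bool -> R).
Context (n_gt0 : (0 < n)%N) (normN : is_norm N).

Lemma norm0 : N 0 = 0.
Proof. by rewrite -(scale0r 0) (norm_homogeneous normN) normr0 mul0r. Qed.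

Lemma normN_opp y : N (- y) = N y.
Proof. by rewrite -scaleN1r (norm_homogeneous normN) normrN1 mul1r. Qed.

Lemma norm_sym y z : N (y - z) = N (z - y).
Proof. by rewrite -opprB normN_opp. Qed.

Lemma norm_ge0 y : 0 <= N y.
Proof.
have := norm_triangle normN y (- y); rewrite subrr norm0 normN_opp.
by rewrite -mulr2n pmulrn_lge0.
Qed.

Lemma norm_gt0 y : y != 0 -> 0 < N y.
Proof.
by rewrite lt_def norm_ge0 andbT; apply: contraNneq => /(norm_definite normN) ->.
Qed.

Definition arm_sign (t : bool) : R := 2 * t%:R - 1.

Lemma arm_sign1 : arm_sign true = 1.
Proof. by rewrite /arm_sign mulr1 addrK. Qed.
Lemma arm_sign0 : arm_sign false = -1.
Proof. by rewrite /arm_sign mulr0 sub0r. Qed.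

Lemma arm_signN t : arm_sign (~~ t) = - arm_sign t.
Proof. by case: t; rewrite /= ?arm_sign1 ?arm_sign0 ?opprK. Qed.

Lemma arm_sign_sqr t : arm_sign t * arm_sign t = 1.
Proof. by case: t; rewrite ?arm_sign1 ?arm_sign0 ?mulrNN mulr1. Qed.

Lemma normr_arm_sign t : `|arm_sign t| = 1.
Proof. by case: t; rewrite ?arm_sign1 ?arm_sign0 ?normrN normr1. Qed.

(** * Unique matches and the matching weights *)

Context (mu : 'I_n -> 'I_n).
Context (muE : forall i, closest_matches N x d i = [set mu i]%SET).

Let mem_mu i : mu i \in closest_matches N x d i.
Proof. by rewrite muE finset.set11. Qed.

Lemma mu_arm i : d (mu i) = ~~ d i.
Proof. by have := mem_mu i; rewrite inE; case: (d _); case: (d _). Qed.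

Definition match_dist i := N (x i - x (mu i)).

Lemma match_dist_le i l : d l != d i -> match_dist i <= N (x i - x l).
Proof.
by move=> dl; have := mem_mu i; rewrite inE => /andP[_ /forallP/(_ l)/implyP->].
Qed.

Lemma match_dist_lt i l : d l != d i -> l != mu i ->
  match_dist i < N (x i - x l).
Proof.
move=> dl; rewrite lt_def match_dist_le// andbT; apply: contraNneq => e.
suff : l \in closest_matches N x d i by rewrite muE finset.in_set1.
rewrite inE dl; apply/forallP => k; apply/implyP => dk.
by rewrite e match_dist_le.
Qed.

Lemma match_countE i : match_count N x d i = #|[set j | mu j == i]%SET|.
Proof.
congr #|pred_of_set _|; apply/setP => j; rewrite [LHS]finset.in_set [RHS]finset.in_set.
have -> : (i \in closest_matches N x d j) = (mu j == i).
  by rewrite muE finset.in_set1 eq_sym.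
have [<-|] := eqVneq (mu j) i; last by rewrite andbF.
by rewrite mu_arm negbK eqxx.
Qed.

Lemma match_count_dup i l : d i = d l -> x i = x l ->
  match_count N x d i = match_count N x d l.
Proof.
move=> dil xil; congr #|pred_of_set _|; apply/setP => j.
by rewrite !inE dil xil.
Qed.

Lemma sum_match (m : 'I_n -> R) :
  \sum_i m (mu i) = \sum_i (match_count N x d i)%:R * m i.
Proof.
rewrite (partition_big mu xpredT)//=; apply: eq_bigr => i _.
rewrite match_countE -sumr_const mulr_suml big_set; apply: eq_big => //.
by move=> j /eqP ->; rewrite mul1r.
Qed.

(** The absolute value of the matching weight. *)
Definition arm_weight i : R := n%:R^-1 * (1 + (match_count N x d i)%:R).

Lemma matching_weightsE i :
  matching_weights N x d i = arm_sign (d i) * arm_weight i.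
Proof. by rewrite /matching_weights /arm_weight /arm_sign; ring. Qed.

Lemma arm_weight_gt0 i : 0 < arm_weight i.
Proof.
by rewrite /arm_weight mulr_gt0 ?invr_gt0 ?ltr0n.
Qed.

Definition match_bias := n%:R^-1 * \sum_i match_dist i.

Lemma sample_ateE f : sample_ate x f =
  n%:R^-1 * \sum_i arm_sign (d i) * (f (x i) (d i) - f (x i) (~~ d i)).
Proof.
congr (_ * _); apply: eq_bigr => i _.
by case: (d i); rewrite /= ?arm_sign1 ?arm_sign0; ring.
Qed.

Lemma sum_arm_weight (m : 'I_n -> R) :
  \sum_i arm_weight i * m i = n%:R^-1 * \sum_i (m i + m (mu i)).
Proof.
rewrite big_split/= sum_match -big_split/= mulr_sumr; apply: eq_bigr => i _.
by rewrite /arm_weight; ring.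
Qed.

(** Each counterfactual outcome differs from the outcome of the match by at most
    [C * match_dist i]. *)
Lemma sample_ate_le C f : 0 <= C -> lipschitz_class N C f ->
  sample_ate x f <=
  \sum_i arm_weight i * (arm_sign (d i) * f (x i) (d i)) + C * match_bias.
Proof.
move=> C0 lipf; rewrite sum_arm_weight sample_ateE.
rewrite /match_bias mulrCA -mulrDr ler_pM2l ?invr_gt0 ?ltr0n//.
rewrite mulr_sumr -big_split/=; apply: ler_sum => i _.
rewrite mu_arm mulrBr -addrA lerD2l arm_signN.
have := lipf (~~ d i) (x i) (x (mu i)); rewrite ler_norml => /andP[].
by rewrite /match_dist; case: (d i); rewrite /= ?arm_sign1 ?arm_sign0; lra.
Qed.

(** * Lipschitz extension of data at the sample points *)

Lemma arm_inhabited t : exists i, d i = t.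
Proof.
pose i0 := Ordinal n_gt0; have [e|e] := eqVneq (d i0) t; first by exists i0.
by exists (mu i0); rewrite mu_arm; case: (d i0) t e => -[].
Qed.

(* McShane's extension, in each arm, of the data prescribed at its units. *)
Lemma lipschitz_extension C (m : 'I_n -> R) : 0 <= C ->
  (forall i l, d i = d l -> m i <= m l + C * N (x i - x l)) ->
  (forall i l, d l != d i ->
    m (mu i) + C * match_dist i <= m l + C * N (x i - x l)) ->
  exists f, [/\ lipschitz_class N C f,
    forall i, f (x i) (d i) = arm_sign (d i) * m i &
    forall i, f (x i) (~~ d i) =
      - arm_sign (d i) * (m (mu i) + C * match_dist i)].
Proof.
move=> C0 m_arm m_match.
have /choice[g gP] : forall yt : 'rV[R]_p * bool, exists i, d i = yt.2 /\
    forall l, d l = yt.2 ->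
      m i + C * N (yt.1 - x i) <= m l + C * N (yt.1 - x l).
  move=> [y t] /=; have [i0 di0] := arm_inhabited t.
  have := @Order.TotalTheory.arg_minP _ _ _ i0 (fun l => d l == t)
    (fun l => m l + C * N (y - x l)).
  case=> [|i /eqP di imin]; first exact/eqP.
  by exists i; split => // l /eqP; exact: imin.
pose v y t := m (g (y, t)) + C * N (y - x (g (y, t))).
have v_le y t l : d l = t -> v y t <= m l + C * N (y - x l).
  by move=> dl; have [_] := gP (y, t); apply.
have v_lip y z t : v y t <= v z t + C * N (y - z).
  have [dg _] := gP (z, t); apply: le_trans (v_le _ _ _ dg) _.
  rewrite /v -addrA lerD2l -mulrDr; apply: ler_wpM2l => //.
  by have := norm_triangle normN (z - x (g (z, t))) (y - z);
     rewrite addrC addrA subrK addrC.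
(* As [v] is the largest extension, the sign gives the largest outcome under treatment and the
   smallest under control, hence the largest average effect. *)
exists (fun y t => arm_sign t * v y t); split.
- move=> t y z; rewrite -mulrBr normrM normr_arm_sign mul1r ler_norml.
  by have := v_lip y z t; have := v_lip z y t; rewrite (norm_sym z y); lra.
- move=> i; congr (_ * _); apply/eqP; rewrite eq_le; apply/andP; split.
    by have := v_le (x i) (d i) i erefl; rewrite subrr norm0 mulr0 addr0.
  by apply: m_arm; have [-> _] := gP (x i, d i).
- move=> i; rewrite arm_signN; congr (_ * _); apply/eqP; rewrite eq_le.
  apply/andP; split; first exact: v_le (mu_arm i).
  by apply: m_match; have [-> _] := gP (x i, ~~ d i); case: (d i).
Qed.

(* Functions of the form [k(x_i, d_i)]. *)
Definition unit_function (T : Type) (m : 'I_n -> T) :=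
  forall i l, d i = d l -> x i = x l -> m i = m l.

(* Data of size [rho * C] are too small to change any unit's best upper bound
   in McShane's extension, which remains the one through its match. *)
Definition matching_margin (rho : R) := forall C (m : 'I_n -> R), 0 <= C ->
  (forall i, `|m i| <= rho * C) -> unit_function m ->
  exists f, [/\ lipschitz_class N C f,
    forall i, f (x i) (d i) = arm_sign (d i) * m i &
    sample_ate x f = \sum_i arm_weight i * m i + C * match_bias].

Lemma matching_margin_ex : exists2 rho : R, 0 < rho & matching_margin rho.
Proof.
have [r1 r10 Hr1] := @finite_pos_lower_bound R ('I_n * 'I_n)%type
  (fun il => x il.1 != x il.2) (fun il => N (x il.1 - x il.2))
  ltac:(by move=> il h; rewrite norm_gt0// subr_eq0).
have [r2 r20 Hr2] := @finite_pos_lower_bound R ('I_n * 'I_n)%type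
  (fun il => (d il.2 != d il.1) && (il.2 != mu il.1))
  (fun il => N (x il.1 - x il.2) - match_dist il.1)
  ltac:(by move=> il /andP[h1 h2]; rewrite subr_gt0 match_dist_lt).
(* [r1] separates distinct covariates and [r2] separates the match of a unit from its next
   candidates. Two data values differ by up to twice their common bound, hence the half. *)
exists (Num.min r1 r2 / 2) => [|C m C0 mb mdup].
  by rewrite divr_gt0// lt_min r10 r20.
have mb' i l : m i <= m l + C * Num.min r1 r2.
  by have := mb i; have := mb l; rewrite !ler_norml; lra.
have [||f [lipf f1 f2]] := @lipschitz_extension C m C0.
- move=> i l dil; have [xil|xil] := eqVneq (x i) (x l).
    by rewrite (mdup i l)// lerDl mulr_ge0// norm_ge0.
  apply: le_trans (mb' i l) _; rewrite lerD2l ler_wpM2l// ge_min.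
  by rewrite (Hr1 (i, l)).
- move=> i l dli; have [->|lmu] := eqVneq l (mu i); first exact: lexx.
  have h : C * Num.min r1 r2 <= C * (N (x i - x l) - match_dist i).
    by rewrite ler_wpM2l// ge_min (Hr2 (i, l)) ?orbT//= dli.
  by have := mb' (mu i) l; lra.
exists f; split => //; rewrite sample_ateE sum_arm_weight /match_bias.
rewrite mulrCA -mulrDr; congr (_ * _); rewrite mulr_sumr -big_split/=.
apply: eq_bigr => i _; rewrite f1 f2.
transitivity ((arm_sign (d i) * arm_sign (d i)) * (m i + m (mu i) + C * match_dist i)).
  by ring.
by rewrite arm_sign_sqr mul1r.
Qed.

(** * Worst-case bias as a function of the weights *)

Local Notation wstar := (matching_weights N x d).

Lemma unit_function_arm_weight : unit_function arm_weight.
Proof. by move=> i l dil xil; rewrite /arm_weight (match_count_dup dil xil). Qed.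

Lemma unit_function_modulus_weights f :
  unit_function (modulus_weights x d sigma2 f).
Proof. by move=> i l dil xil; rewrite /modulus_weights dil xil. Qed.

Definition weight_dist (k : 'I_n -> R) := \sum_i `|k i - wstar i|.

Lemma weight_dist_gt0 k i : k i != wstar i -> 0 < weight_dist k.
Proof.
move=> ki; rewrite /weight_dist (bigD1 i)//= ltr_wpDr ?normr_gt0 ?subr_eq0//.
by apply: sumr_ge0.
Qed.

Lemma lipschitz_class_opp C f : lipschitz_class N C f ->
  lipschitz_class N C (fun y t => - f y t).
Proof. by move=> lipf t y z; rewrite -opprD normrN; exact: lipf. Qed.

Lemma sample_ate_opp f : sample_ate x (fun y t => - f y t) = - sample_ate x f.
Proof.
rewrite /sample_ate -mulrN -sumrN; congr (_ * _); apply: eq_bigr => i _.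
by rewrite opprB opprK addrC.
Qed.

Lemma worst_bias_ge rho C k : matching_margin rho -> 0 <= rho -> 0 <= C ->
  unit_function k ->
  ((C * match_bias + C * rho * weight_dist k)%:E <=
     worst_bias x d (lipschitz_class N C) k)%E.
Proof.
move=> margin rho0 C0 kdup.
(* With these signs each unit adds [C * rho] times the deviation of its weight. The extension makes
   the average effect large, so its negation is the one with large bias. *)
pose m i := rho * C * Num.sg (arm_weight i - arm_sign (d i) * k i).
have [||f [lipf f1 f2]] := margin C m C0.
- move=> i; rewrite /m normrM (ger0_norm (mulr_ge0 rho0 C0)).
  rewrite ler_piMr ?mulr_ge0// normr_sg.
  by case: (_ != 0); rewrite ?lexx ?ler01.
- move=> i l dil xil.
  by rewrite /m (kdup _ _ dil xil) dil (unit_function_arm_weight dil xil).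
apply: ereal_sup_ubound; exists (fun y t => - f y t).
  exact: lipschitz_class_opp.
congr EFin; rewrite sample_ate_opp opprK f2 addrCA addrA [RHS]addrC; congr (_ + _).
rewrite -big_split/= /weight_dist mulr_sumr; apply: eq_bigr => i _.
rewrite f1 matching_weightsE.
have -> : `|k i - arm_sign (d i) * arm_weight i| =
    `|arm_weight i - arm_sign (d i) * k i|.
  rewrite -[LHS]mul1r -(normr_arm_sign (d i)) -normrM mulrBr mulrA.
  by rewrite arm_sign_sqr mul1r distrC.
rewrite normrEsg /m; ring.
Qed.

Lemma worst_bias_matching rho C : matching_margin rho -> 0 <= rho -> 0 <= C ->
  worst_bias x d (lipschitz_class N C) wstar = (C * match_bias)%:E.
Proof.
move=> margin rho0 C0; apply/eqP; rewrite eq_le; apply/andP; split.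
  apply: ge_ereal_sup => _ [f lipf <-]; rewrite lee_fin.
  have := sample_ate_le C0 (lipschitz_class_opp lipf); rewrite sample_ate_opp.
  move=> h; rewrite -lerBrDl; apply: le_trans h _.
  rewrite addrC lerD2l -sumrN; apply: ler_sum => i _.
  by rewrite matching_weightsE; lra.
have := worst_bias_ge margin rho0 C0 (k := wstar).
have -> : weight_dist wstar = 0.
  by rewrite /weight_dist big1// => i _; rewrite subrr normr0.
rewrite mulr0 addr0; apply => i l dil xil.
by rewrite !matching_weightsE dil (unit_function_arm_weight dil xil).
Qed.

(** Functions constant on one arm and zero on the other are in the class at any size, so finite bias
    forces the estimator to be exact on them. *)
Lemma worst_bias_arm_sum C k B t : 0 <= C ->
  worst_bias x d (lipschitz_class N C) k = B%:E ->
  \sum_(i | d i == t) k i = arm_sign t.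
Proof.
move=> C0 kB; apply/eqP; rewrite -subr_eq0; apply/negPn/negP => e0.
(* Scaled so that the function has bias exactly [B + 1]. *)
set e := _ - _ in e0; pose a := (B + 1) / e.
suff : (B + 1 <= B) by lra.
rewrite -lee_fin -kB; apply: ereal_sup_ubound.
exists (fun _ t' => a * (t' == t)%:R).
  by move=> t' y z; rewrite subrr normr0 mulr_ge0// norm_ge0.
congr EFin; transitivity (a * e); last by rewrite /a divfK.
rewrite /e mulrBr; congr (_ - _).
  rewrite [in RHS]big_mkcond/= mulr_sumr; apply: eq_bigr => i _.
  by case: (d i == t); rewrite /= ?mulr1 ?mulr0 // mulrC.
rewrite /sample_ate sumr_const card_ord -[X in _ * X]mulr_natl mulrA mulVf ?mul1r.
  by case: (t); rewrite ?arm_sign1 ?arm_sign0 /= !(mulr1, mulr0, subr0, sub0r, mulrN1).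
by rewrite pnatr_eq0 -lt0n.
Qed.

(** * Standard deviation of linear estimators *)

Context (sigma2_gt0 : forall i, 0 < sigma2 (x i) (d i)).

Local Notation var i := (sigma2 (x i) (d i)).
Local Notation sd := (sd x d sigma2).

Lemma sd_sqr k : sd k ^+ 2 = \sum_i k i ^+ 2 * var i.
Proof.
rewrite sqr_sqrtr//; apply: sumr_ge0 => i _.
by rewrite mulr_ge0 ?sqr_ge0// ltW.
Qed.

Lemma sd_ge_term k i : `|k i| * Num.sqrt (var i) <= sd k.
Proof.
rewrite -(sqrtr_sqr (k i)) -sqrtrM ?sqr_ge0// ler_wsqrtr//.
rewrite (bigD1 i)//= lerDl; apply: sumr_ge0 => j _.
by rewrite mulr_ge0 ?sqr_ge0// ltW.
Qed.

Lemma sd_gt0 k i : k i != 0 -> 0 < sd k.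
Proof.
move=> ki; apply: lt_le_trans (sd_ge_term k i).
by rewrite mulr_gt0 ?normr_gt0// sqrtr_gt0.
Qed.

Lemma sd_matching_gt0 : 0 < sd wstar.
Proof.
apply: (@sd_gt0 _ (Ordinal n_gt0)); rewrite matching_weightsE -normr_gt0 normrM.
by rewrite normr_arm_sign mul1r normr_gt0 gt_eqF// arm_weight_gt0.
Qed.

Lemma sd_lipschitz : exists2 M, 0 <= M & forall k : 'I_n -> R,
  `|sd k - sd wstar| <= M * weight_dist k.
Proof.
exists (\sum_i Num.sqrt (var i)) => [|k]; first by apply: sumr_ge0.
have s0 := sd_matching_gt0; have s1 : 0 <= sd k by exact: sqrtr_ge0.
have ss : 0 < sd k + sd wstar by rewrite ltr_wpDl.
(* Multiplying by [sd k + sd wstar] turns the difference into one of variances; in each term the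
   factor with [k i + wstar i] is at most this sum. *)
rewrite -(ler_pM2r ss) -[X in _ * X <= _](ger0_norm (ltW ss)) -normrM.
rewrite -subr_sqr !sd_sqr -sumrB.
apply: le_trans (ler_norm_sum _ _ _) _.
rewrite /weight_dist mulr_sumr mulr_suml; apply: ler_sum => i _.
have v0 := sqrtr_ge0 (var i).
rewrite -mulrBl -[X in _ * X](sqr_sqrtr (ltW (sigma2_gt0 i))) subr_sqr.
have -> : `|(k i - wstar i) * (k i + wstar i) * Num.sqrt (var i) ^+ 2| =
  Num.sqrt (var i) * `|k i - wstar i| * (`|k i + wstar i| * Num.sqrt (var i)).
  by rewrite !normrM (ger0_norm v0); ring.
apply: ler_pM; rewrite ?mulr_ge0//.
  apply: ler_wpM2r => //; rewrite (bigD1 i)//= lerDl.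
  by apply: sumr_ge0.
apply: le_trans (_ : (`|k i| + `|wstar i|) * Num.sqrt (var i) <= _).
  by apply: ler_wpM2r => //; exact: ler_normD.
by rewrite mulrDl lerD ?sd_ge_term.
Qed.

(** * The modulus problem for small [delta] *)

Lemma sum_treated_arm_weight : \sum_i (d i)%:R * arm_weight i = 1.
Proof.
under eq_bigr do rewrite mulrC.
rewrite sum_arm_weight.
(* Exactly one of a unit and its match is treated. *)
under eq_bigr => i _.
  rewrite mu_arm (_ : _ + _ = 1); last by case: (d i); rewrite ?addr0 ?add0r.
  over.
by rewrite sumr_const card_ord mulVf// pnatr_eq0 -lt0n.
Qed.

Lemma modulus_weights_small_delta rho C : matching_margin rho -> 0 < rho ->
  0 < C -> exists2 delta : R, 0 < delta &
  forall f, modulus_solution N x d sigma2 C delta f ->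
    modulus_weights x d sigma2 f =1 wstar.
Proof.
move=> margin rho0 C0.
pose T := \sum_i arm_weight i * var i.
have wv0 i : 0 < arm_weight i * var i by rewrite mulr_gt0 ?arm_weight_gt0.
have T0 : 0 < T.
  by rewrite /T (bigD1 (Ordinal n_gt0))//= ltr_wpDr// sumr_ge0// => j _; exact: ltW.
(* This scale keeps the data [m], which maximize the linear form with coefficients [arm_weight] on
   their ellipsoid, within the margin [rho * C]. *)
have [lam lam0 lamT] : exists2 lam, 0 < lam & lam * T = rho * C.
  exists (rho * C / T); first by rewrite divr_gt0// mulr_gt0.
  by rewrite divfK// gt_eqF.
pose m i := lam * (arm_weight i * var i).
pose V := \sum_i arm_weight i ^+ 2 * var i.
have V0 : 0 < V.
  rewrite /V (bigD1 (Ordinal n_gt0))//= ltr_wpDr//.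
    by apply: sumr_ge0 => j _; rewrite mulr_ge0 ?sqr_ge0// ltW.
  by rewrite mulr_gt0// exprn_gt0// arm_weight_gt0.
have [||g [lipg g1 g2]] := margin C m (ltW C0).
- move=> i; rewrite /m ger0_norm; last by rewrite mulr_ge0// ltW.
  rewrite -lamT ler_pM2l// /T (bigD1 i)//= lerDl; apply: sumr_ge0 => j _; exact: ltW.
- by move=> i l dil xil; rewrite /m (unit_function_arm_weight dil xil) dil xil.
exists (2 * lam * Num.sqrt V); first by rewrite pmulr_rgt0 ?sqrtr_gt0// pmulr_rgt0.
have dV : (2 * lam * Num.sqrt V) ^+ 2 / 4 = lam ^+ 2 * V.
  by rewrite !exprMn sqr_sqrtr ?ltW//; field.
have quad f : \sum_i f (x i) (d i) ^+ 2 / var i =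
    \sum_i (arm_sign (d i) * f (x i) (d i)) ^+ 2 / var i.
  by apply: eq_bigr => i _; rewrite exprMn [arm_sign _ ^+ 2]arm_sign_sqr mul1r.
have Wm : \sum_i arm_weight i * m i = lam * V.
  by rewrite /V mulr_sumr; apply: eq_bigr => i _; rewrite /m; ring.
move=> f [[lipf]]; rewrite dV quad => fle fopt.
pose v i := arm_sign (d i) * f (x i) (d i).
(* The extension [g] of [m] is feasible and attains the bound of [sample_ate_le], so the linear form
   at [f] is at least its value at [m]. *)
have {}fopt : lam * V <= \sum_i arm_weight i * v i.
  have h := sample_ate_le (ltW C0) lipf.
  have : 2 * sample_ate x g <= 2 * sample_ate x f.
    apply: fopt; split => //; rewrite dV quad le_eqVlt; apply/orP; left; apply/eqP.
    rewrite /V mulr_sumr; apply: eq_bigr => i _.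
    rewrite g1 mulrA arm_sign_sqr mul1r /m; field.
    by rewrite gt_eqF.
  by rewrite g2 Wm; rewrite -/(v _) in h *; lra.
(* The equality case of Cauchy-Schwarz, by expanding the square. *)
have dist : \sum_i (v i - m i) ^+ 2 / var i <= 0.
  have -> : \sum_i (v i - m i) ^+ 2 / var i = \sum_i v i ^+ 2 / var i
      - 2 * lam * \sum_i arm_weight i * v i + lam ^+ 2 * V.
    rewrite /V !mulr_sumr -sumrB -big_split/=; apply: eq_bigr => i _.
    by rewrite /m; field; rewrite gt_eqF.
  have : lam * (lam * V) <= lam * \sum_i arm_weight i * v i by rewrite ler_pM2l.
  by rewrite -/(v _) in fle; lra.
have vm i : v i = m i.
  have t0 j : 0 <= (v j - m j) ^+ 2 / var j by rewrite divr_ge0 ?sqr_ge0// ltW.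
  have : \sum_i (v i - m i) ^+ 2 / var i == 0.
    by rewrite eq_le dist/=; apply: sumr_ge0 => j _; exact: t0.
  rewrite psumr_eq0// => /allP/(_ i (mem_index_enum _)) /=.
  rewrite mulf_eq0 invr_eq0 (gt_eqF (sigma2_gt0 i)) orbF sqrf_eq0 subr_eq0.
  by move/eqP.
have fE i : f (x i) (d i) / var i = lam * (arm_sign (d i) * arm_weight i).
  have -> : f (x i) (d i) = arm_sign (d i) * v i.
    by rewrite /v mulrA arm_sign_sqr mul1r.
  by rewrite vm /m; field; rewrite gt_eqF.
move=> i; rewrite /modulus_weights fE matching_weightsE.
have -> : \sum_j (d j)%:R * f (x j) (d j) / sigma2 (x j) (d j) = lam.
  rewrite -[RHS]mulr1 -[X in _ = _ * X]sum_treated_arm_weight mulr_sumr; apply: eq_bigr => j _.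
  rewrite -mulrA fE; case: (d j); last by rewrite !mul0r mulr0.
  by rewrite arm_sign1 !mul1r.
by rewrite mulrAC divff ?mul1r// gt_eqF.
Qed.

(** At zero distance a unit is also a closest match of its own match, so uniqueness makes [mu] an
    involution and every match count one. *)
Lemma matching_weights_exact : match_bias = 0 ->
  forall i, wstar i = arm_sign (d i) * (2 / n%:R).
Proof.
move=> b0 i; rewrite matching_weightsE; congr (_ * _).
have D0 j : match_dist j = 0.
  apply/eqP; move: b0 => /eqP.
  rewrite /match_bias mulf_eq0 invr_eq0 pnatr_eq0 -leqn0 leqNgt n_gt0/=.
  rewrite psumr_eq0 => [/allP/(_ j (mem_index_enum _))//|l _].
  exact: norm_ge0.
have muK j : mu (mu j) = j.
  suff : j \in closest_matches N x d (mu j).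
    by rewrite muE finset.in_set1 => /eqP.
  rewrite inE mu_arm -{1}(negbK (d j)); apply/andP; split; first by case: (d j).
  apply/forallP => l; apply/implyP => _.
  by rewrite norm_sym; have := D0 j; rewrite /match_dist => ->; exact: norm_ge0.
rewrite /arm_weight match_countE.
rewrite (_ : [set j | mu j == i]%SET = [set mu i]%SET) ?cards1.
  by ring.
apply/setP => j; rewrite finset.in_set finset.in_set1.
by apply/eqP/eqP => [<-|->]; rewrite muK.
Qed.

(** Pythagoras: [wstar j * var j] is constant on each arm, where [k] and [wstar] have equal sums, so
    [k - wstar] is orthogonal to [wstar] in the variance inner product. *)
Lemma sd_exact C k B i : arm_homoskedastic x d sigma2 -> match_bias = 0 ->
  0 <= C -> worst_bias x d (lipschitz_class N C) k = B%:E ->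
  k i != wstar i -> sd wstar < sd k.
Proof.
move=> hom b0 C0 kB ki.
have [rho rho0 margin] := matching_margin_ex.
have cross : \sum_j (k j - wstar j) * (wstar j * var j) = 0.
  rewrite (partition_big d xpredT)//= big1// => t _.
  have [i0 di0] := arm_inhabited t.
  rewrite (eq_bigr (fun j => (k j - wstar j) * (wstar i0 * var i0))).
    rewrite -mulr_suml sumrB (worst_bias_arm_sum _ C0 kB).
    rewrite (worst_bias_arm_sum _ C0 (worst_bias_matching margin (ltW rho0) C0)).
    by rewrite subrr mul0r.
  move=> j /eqP dj; rewrite !matching_weights_exact// dj di0.
  by have := hom j i0; rewrite dj di0 => /(_ erefl) ->.
rewrite -(@ltr_pXn2r R 2)// ?nnegrE ?sqrtr_ge0//.
rewrite !sd_sqr -subr_gt0 -sumrB.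
rewrite (eq_bigr (fun j => (k j - wstar j) ^+ 2 * var j
    + 2 * ((k j - wstar j) * (wstar j * var j)))); last by move=> j _; ring.
rewrite big_split/= -mulr_sumr cross mulr0 addr0.
rewrite (bigD1 i)//= ltr_wpDr//.
  by apply: sumr_ge0 => j _; rewrite mulr_ge0 ?sqr_ge0// ltW.
by rewrite mulr_gt0// exprn_even_gt0//= subr_eq0.
Qed.

(** * Strict optimality of the matching weights in both criteria *)

Local Notation mse C := (mean_squared_error x d sigma2 (lipschitz_class N C)).
Local Notation flci alpha C :=
  (flci_half_length x d sigma2 alpha (lipschitz_class N C)).

Lemma match_bias_ge0 : 0 <= match_bias.
Proof.
rewrite mulr_ge0 ?invr_ge0 ?ler0n//; apply: sumr_ge0 => i _; exact: norm_ge0.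
Qed.

Lemma match_bias_gt0 : inexact_match x d -> 0 < match_bias.
Proof.
move=> [i xi]; rewrite mulr_gt0 ?invr_gt0 ?ltr0n// (bigD1 i)//= ltr_wpDr//.
  by apply: sumr_ge0 => j _; exact: norm_ge0.
rewrite norm_gt0// subr_eq0 eq_sym xi// mu_arm.
by case: (d i).
Qed.

Lemma sd_finite_bias_gt0 C k B : 0 <= C ->
  worst_bias x d (lipschitz_class N C) k = B%:E -> 0 < sd k.
Proof.
move=> C0 kB; have := worst_bias_arm_sum true C0 kB.
have [/existsP[i ki] _|/existsPn k0] := boolP [exists i, k i != 0].
  exact: sd_gt0 ki.
rewrite big1 => [|i _]; last by apply/eqP; have := k0 i; rewrite negbK.
by rewrite arm_sign1 => /esym/eqP; rewrite oner_eq0.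
Qed.

Lemma matching_dominates_infinite_bias C k : 0 <= C ->
  worst_bias x d (lipschitz_class N C) k = +oo%E ->
  forall rho alpha, 0 < rho -> matching_margin rho ->
  (mse C wstar < mse C k)%E /\ (flci alpha C wstar < flci alpha C k)%E.
Proof.
move=> C0 kB rho alpha rho0 margin.
rewrite /mean_squared_error /flci_half_length kB.
rewrite (worst_bias_matching margin (ltW rho0) C0); split; last exact: ltry.
by rewrite -EFin_expe -EFinD expe2 mulyy addye// ltry.
Qed.

Lemma matching_dominates alpha : 0 < alpha -> alpha < 1 ->
  inexact_match x d \/ arm_homoskedastic x d sigma2 ->
  exists2 C0 : R, 0 <= C0 & forall C : R, C0 < C -> forall k i, unit_function k ->
    k i != wstar i ->
    (mse C wstar < mse C k)%E /\ (flci alpha C wstar < flci alpha C k)%E.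
Proof.
move=> a0 a1 nondeg.
have [rho rho0 margin] := matching_margin_ex.
have [M M0 HM] := sd_lipschitz.
have s0 := sd_matching_gt0.
have [C0 C00 HC0] : exists2 C0, 0 <= C0 & forall C, C0 < C -> forall k i B,
    worst_bias x d (lipschitz_class N C) k = B%:E ->
    k i != wstar i -> C * match_bias + C * rho * weight_dist k <= B ->
    (C * match_bias) ^+ 2 + sd wstar ^+ 2 < B ^+ 2 + sd k ^+ 2 /\
    cv alpha (C * match_bias / sd wstar) * sd wstar < cv alpha (B / sd k) * sd k.
  have := match_bias_ge0; rewrite le_eqVlt => /orP[/eqP b0|b0]; last first.
    have [C1 HC1] := cv_scale_lt_inexact a0 a1 b0 s0 rho0 M0.
    (* The last bound lets the cross term of the squared bias, of order [C ^+ 2], outweigh the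
       largest first-order drop [2 * s * (M * t)] in variance. *)
    exists (Num.max 1 (Num.max C1 (sd wstar * M / (match_bias * rho)))).
      by rewrite le_max ler01.
    move=> C; rewrite !gt_max => /and3P[C_gt1 C_gt C_gt'] k i B kB ki HB.
    have C_ge0 : 0 <= C by lra.
    have t0 := weight_dist_gt0 ki.
    have sk0 := sd_finite_bias_gt0 C_ge0 kB.
    split; last exact: HC1 (HM k).
    set t := weight_dist k in t0 HB *; set b := match_bias in b0 C_gt' HB *.
    set s := sd wstar in s0 C_gt' *.
    have := HM k; rewrite -/t -/s ler_norml => /andP[Hs _].
    have A0 : 0 <= C * b by rewrite mulr_ge0// ltW.
    have E0 : 0 <= C * rho * t by rewrite !mulr_ge0// ltW.
    have hB : (C * b + C * rho * t) ^+ 2 <= B ^+ 2.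
      by rewrite ler_pXn2r ?nnegrE//; lra.
    have hs : s ^+ 2 - 2 * s * (M * t) <= sd k ^+ 2.
      (* In the first case the left-hand side is nonpositive, and the square cannot be compared
         monotonically. *)
      have [h|h] := leP s (M * t).
        have : s * s <= s * (M * t) by rewrite ler_pM2l.
        by have := sqr_ge0 (sd k); have := sqr_ge0 s; rewrite !expr2; lra.
      have : (s - M * t) ^+ 2 <= sd k ^+ 2 by rewrite ler_pXn2r ?nnegrE//; lra.
      by have := sqr_ge0 (M * t); lra.
    have hC : s * M * t < C * b * (C * rho * t).
      have h1 : s * M < C * (b * rho).
        by move: C_gt'; rewrite ltr_pdivrMr// mulr_gt0.
      have h2 : C * (b * rho) <= C * (C * (b * rho)).
        have h0 : 0 <= C * (b * rho).
          by apply: le_trans (ltW h1); rewrite mulr_ge0// ltW.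
        by rewrite ler_peMl// ltW.
      have : s * M * t < C * (C * (b * rho)) * t.
        by rewrite ltr_pM2r//; lra.
      by lra.
    have := sqr_ge0 (C * rho * t); lra.
  have hom : arm_homoskedastic x d sigma2.
    by case: nondeg => // /match_bias_gt0; rewrite -b0 ltxx.
  exists 0 => // C C_gt0 k i B kB ki HB.
  have ss := sd_exact hom (esym b0) (ltW C_gt0) kB ki.
  have B0 : 0 <= B.
    apply: le_trans HB; rewrite -b0 mulr0 add0r !mulr_ge0 ?ltW//.
    exact: weight_dist_gt0 ki.
  rewrite -b0 mulr0 mul0r; split; last exact: cv_scale_lt_exact.
  rewrite expr0n/= add0r ltr_wpDl ?sqr_ge0//.
  by rewrite ltr_pXn2r// nnegrE ltW// (lt_trans s0).
exists C0 => // C CC k i kunit ki.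
have C_ge0 : 0 <= C by exact: le_trans C00 (ltW CC).
have := worst_bias_ge margin (ltW rho0) C_ge0 kunit.
case kB : (worst_bias _ _ _ _) => [B| |//].
  rewrite lee_fin => HB; have [h1 h2] := HC0 C CC k i B kB ki HB.
  rewrite /mean_squared_error /flci_half_length kB.
  rewrite (worst_bias_matching margin (ltW rho0) C_ge0).
  by rewrite -!EFin_expe -!EFinD !lte_fin.
move=> _; exact: matching_dominates_infinite_bias kB _ _ rho0 margin.
Qed.

End Matching.

(** * Minimizers over [delta] *)

Unset Implicit Arguments.
Set Strict Implicit.

Theorem theorem2p3 (R : realType) (n p : nat) (N : 'rV[R]_p -> R)
    (x : 'I_n -> 'rV[R]_p) (d : 'I_n -> bool)
    (sigma2 : 'rV[R]_p -> bool -> R) (alpha : R)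
    (hn : (0 < n)%N) (hN : is_norm N)
    (halpha0 : 0 < alpha) (halpha1 : alpha < 1)
    (hsigma : forall i, 0 < sigma2 (x i) (d i))
    (hmatch : forall i, #|closest_matches N x d i| = 1%N)
    (hnondegenerate : inexact_match x d \/ arm_homoskedastic x d sigma2) :
  exists C0 : R, forall C : R, C0 < C ->
  forall fstar : R -> 'rV[R]_p -> bool -> R,
  (forall delta : R, 0 < delta ->
     modulus_solution N x d sigma2 C delta (fstar delta)) ->
  let F := lipschitz_class N C in
  let kstar := fun delta : R => modulus_weights x d sigma2 (fstar delta) in
  let rmse := fun delta : R => mean_squared_error x d sigma2 F (kstar delta) in
  let flci := fun delta : R => flci_half_length x d sigma2 alpha F (kstar delta) in
  let is_matching := fun delta : R =>
    forall Y : 'I_n -> R,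
      linear_estimator (kstar delta) Y
      = linear_estimator (matching_weights N x d) Y in
  ((exists delta : R, minimizes_pos rmse delta) /\
   (exists delta : R, minimizes_pos flci delta)) /\
  (forall delta_rmse : R, minimizes_pos rmse delta_rmse ->
     is_matching delta_rmse) /\
  (forall delta_flci : R, minimizes_pos flci delta_flci ->
     is_matching delta_flci).
Proof.
have /choice[mu muE] : forall i, exists j, closest_matches N x d i = [set j]%SET.
  by move=> i; have /eqP/cards1P := hmatch i.
have [C0 C00 dom] :=
  matching_dominates hn hN muE hsigma halpha0 halpha1 hnondegenerate.
exists C0 => C CC fstar sol F kstar rmse flci is_matching.
have [rho rho0 margin] := matching_margin_ex hn hN muE.
have [delta0 delta00 small] := modulus_weights_small_delta hn muE hsigma
  margin rho0 (le_lt_trans C00 CC).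
have kE : kstar delta0 = matching_weights N x d.
  by apply/funext => i; exact: small (sol _ delta00) i.
(* The strict alternative makes every minimizer, and not only [delta0], produce the matching
   weights. *)
have kstarP delta : kstar delta = matching_weights N x d \/
    (rmse delta0 < rmse delta)%E /\ (flci delta0 < flci delta)%E.
  have [k0|/existsNP[i ki]] :=
    pselect (forall i, kstar delta i = matching_weights N x d i).
    by left; exact/funext.
  right; have kunit := @unit_function_modulus_weights _ _ _ x d sigma2 (fstar delta).
  by rewrite /rmse /flci kE; apply: (dom C CC _ i kunit); exact/eqP.
have rmse_ge delta : (rmse delta0 <= rmse delta)%E.
  by case: (kstarP delta) => [k|[/ltW]//]; rewrite /rmse k kE.
have flci_ge delta : (flci delta0 <= flci delta)%E.
  by case: (kstarP delta) => [k|[_ /ltW]//]; rewrite /flci k kE.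
split; first by split; exists delta0; split.
split=> delta [_ /(_ _ delta00)];
  by case: (kstarP delta) => [k _ Y|[h1 h2]]; rewrite ?k// leNgt ?h1 ?h2.
Qed.
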